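(* Each of the following eight pairs $(X_k,Y_k)$, $k=1,\ldots,8$, of subsets of $\mathbb{Z}_{72}$ is a supplementary difference set (SDS) with parameters $(72;36,30;30)$. These eight SDSs are pairwise nonequivalent. For each $k$, the pair of binary sequences of length $72$ associated to $X_k$ and $Y_k$ is a periodic Golay pair. In particular, periodic Golay pairs of length $72$ exist. (1) $X_1=\{0,1,2,3,4,5,6,7,10,12,13,15,18,20,22,24,26,27,29,30,31,35,37,39,40,43,44,47,51,52,53,56,58,59,62,63\}$, $Y_1=\{0,1,2,3,5,6,8,11,12,13,14,15,18,21,23,25,29,32,33,39,41,42,43,47,48,55,56,62,67,69\}$; (2) $X_2=\{0,1,2,3,4,5,6,7,10,12,13,15,18,20,22,24,26,27,29,30,31,35,37,39,40,43,44,47,51,52,53,56,58,59,62,63\}$, $Y_2=\{0,2,3,5,7,8,9,11,14,15,17,18,19,23,24,30,31,32,33,37,38,41,42,44,48,49,51,59,61,69\}$; (3) $X_3=\{0,1,2,3,5,7,10,11,12,13,15,17,19,20,26,27,28,29,30,32,34,35,38,39,40,42,43,46,49,51,54,56,59,60,63,64\}$, $Y_3=\{0,1,2,3,4,6,7,8,9,14,15,16,20,22,24,26,27,31,33,36,37,40,42,43,46,49,54,57,58,68\}$; (4) $X_4=\{0,1,2,3,5,7,10,11,12,13,15,17,19,20,26,27,28,29,30,32,34,35,38,39,40,42,43,46,49,51,54,56,59,60,63,64\}$, $Y_4=\{0,1,3,4,6,7,8,9,10,14,15,18,19,20,22,25,26,31,32,36,38,40,42,45,49,51,52,57,58,60\}$;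 (5) $X_5=\{0,1,2,4,5,6,7,9,10,11,14,15,16,17,22,23,25,26,29,30,33,35,37,38,43,45,46,48,50,51,52,54,55,60,62,63\}$, $Y_5=\{0,2,3,5,7,8,9,11,14,17,18,19,21,23,24,27,30,31,32,37,38,41,42,44,48,49,57,59,61,63\}$; (6) $X_6=\{0,1,3,4,5,6,7,8,9,10,14,15,17,18,19,20,22,25,26,29,31,32,36,38,40,41,42,45,49,51,52,53,57,58,60,65\}$, $Y_6=\{0,1,2,5,7,10,11,12,13,17,19,20,26,28,29,30,32,34,35,38,40,42,43,46,49,54,56,59,60,64\}$; (7) $X_7=\{0,1,3,4,5,6,7,8,9,10,14,15,17,18,19,20,22,25,26,29,31,32,36,38,40,41,42,45,49,51,52,53,57,58,60,65\}$, $Y_7=\{0,1,3,4,5,6,9,10,13,16,18,19,21,23,24,27,30,34,35,40,46,47,48,49,53,55,57,63,65,67\}$; (8) $X_8=\{0,2,3,4,5,7,8,9,11,14,15,16,17,18,19,23,24,28,30,31,32,33,37,38,40,41,42,44,48,49,51,52,59,61,64,69\}$, $Y_8=\{0,1,2,4,5,6,7,10,12,13,18,20,22,24,26,29,30,31,35,37,40,43,44,47,52,53,56,58,59,62\}$.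
   Context: $\mathbb{Z}_v=\{0,1,\ldots,v-1\}$ is the ring of integers modulo $v$. A pair $(X,Y)$ of subsets of $\mathbb{Z}_v$ is a supplementary difference set (SDS) with parameters $(v;r,s;\lambda)$ if $|X|=r$, $|Y|=s$, and for every nonzero $c\in\mathbb{Z}_v$ the number of ordered pairs $(a,b)\in X\times X$ with $a-b=c$ plus the number of ordered pairs $(a,b)\in Y\times Y$ with $a-b=c$ equals $\lambda$. Two SDSs with the same parameters are equivalent if one can be obtained from the other by a finite sequence of the following operations: replacing one of the two sets by a translate of it; replacing one of the two sets by its negative; multiplying both sets by the same unit of $\mathbb{Z}_v$; interchanging the two sets if they have the same size. A binary sequence of length $v$ is a sequence $A=[a_0,\ldots,a_{v-1}]$ with all $a_i\in\{1,-1\}$. The binary sequence associated to a subset $X\subseteq\mathbb{Z}_v$ is $[x_0,\ldots,x_{v-1}]$ with $x_i=-1$ if $i\in X$ and $x_i=+1$ otherwise. The periodic autocorrelation function of a binary sequence $A$ of length $v$ is $\mathrm{PAF}_A(s)=\sum_{j=0}^{v-1}a_{j+s}a_j$ for $s\in\mathbb{Z}_v$, with indices computed modulo $v$. A pair $(A,B)$ of binary sequences of length $v$ is a periodic Golay pair if $\mathrm{PAF}_A(s)+\mathrm{PAF}_B(s)=0$ for all $s\neq 0$ in $\mathbb{Z}_v$. *)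

(* Defs.v *)
From Stdlib Require Export Relation_Operators.
From mathcomp Require Export all_boot all_order all_algebra.

Set Implicit Arguments.
Unset Strict Implicit.
Unset Printing Implicit Defensive.

Import GRing.Theory.
Local Open Scope ring_scope.

(* 'Z_v is the ring of integers modulo v only for v > 1: 'Z_0 and 'Z_1 both
   denote Z/2, so the notions below are meaningful only when v > 1. *)

Definition diff_count (v : nat) (X : {set 'Z_v}) (c : 'Z_v) : nat :=
  #|[set p : 'Z_v * 'Z_v | [&& p.1 \in X, p.2 \in X & p.1 - p.2 == c]]|.

Definition is_sds (v r s lambda : nat) (X Y : {set 'Z_v}) : Prop :=
  [/\ #|X| = r, #|Y| = s &
      forall c : 'Z_v, c != 0 ->
        (diff_count X c + diff_count Y c)%N = lambda].

Inductive sds_step (v : nat) :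
    {set 'Z_v} * {set 'Z_v} -> {set 'Z_v} * {set 'Z_v} -> Prop :=
| StepTranslateL (X Y : {set 'Z_v}) (t : 'Z_v) :
    sds_step (X, Y) ([set x + t | x in X], Y)
| StepTranslateR (X Y : {set 'Z_v}) (t : 'Z_v) :
    sds_step (X, Y) (X, [set y + t | y in Y])
| StepNegL (X Y : {set 'Z_v}) :
    sds_step (X, Y) ([set - x | x in X], Y)
| StepNegR (X Y : {set 'Z_v}) :
    sds_step (X, Y) (X, [set - y | y in Y])
| StepUnit (X Y : {set 'Z_v}) (u : 'Z_v) :
    u \is a GRing.unit ->
    sds_step (X, Y) ([set u * x | x in X], [set u * y | y in Y])
| StepSwap (X Y : {set 'Z_v}) :
    #|X| = #|Y| -> sds_step (X, Y) (Y, X).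

(* Every step preserves the SDS property and its parameters, so the pairs
   visited between two SDSs need not be required to be SDSs. *)
Definition sds_equiv (v : nat) (P Q : {set 'Z_v} * {set 'Z_v}) : Prop :=
  clos_refl_trans _ (@sds_step v) P Q.

(* A sequence of length v is indexed by 'Z_v, so that index arithmetic is
   modulo v. *)
Definition is_binary (v : nat) (A : {ffun 'Z_v -> int}) : Prop :=
  forall i : 'Z_v, A i = 1 \/ A i = -1.

Definition binary_seq (v : nat) (X : {set 'Z_v}) : {ffun 'Z_v -> int} :=
  [ffun i => if i \in X then -1 else 1].

Definition paf (v : nat) (A : {ffun 'Z_v -> int}) (s : 'Z_v) : int :=
  \sum_(j : 'Z_v) A (j + s) * A j.

Definition periodic_golay_pair (v : nat) (A B : {ffun 'Z_v -> int}) : Prop :=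
  [/\ is_binary A, is_binary B &
      forall s : 'Z_v, s != 0 -> paf A s + paf B s = 0].

Definition residues (v : nat) (l : seq nat) : {set 'Z_v} :=
  [set i : 'Z_v | val i \in l].

Definition pairs72 : seq (seq nat * seq nat) :=
  [::
    ([:: 0; 1; 2; 3; 4; 5; 6; 7; 10; 12; 13; 15; 18; 20; 22; 24; 26;
         27; 29; 30; 31; 35; 37; 39; 40; 43; 44; 47; 51; 52; 53; 56;
         58; 59; 62; 63],
     [:: 0; 1; 2; 3; 5; 6; 8; 11; 12; 13; 14; 15; 18; 21; 23; 25; 29;
         32; 33; 39; 41; 42; 43; 47; 48; 55; 56; 62; 67; 69]);
    ([:: 0; 1; 2; 3; 4; 5; 6; 7; 10; 12; 13; 15; 18; 20; 22; 24; 26;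
         27; 29; 30; 31; 35; 37; 39; 40; 43; 44; 47; 51; 52; 53; 56;
         58; 59; 62; 63],
     [:: 0; 2; 3; 5; 7; 8; 9; 11; 14; 15; 17; 18; 19; 23; 24; 30; 31;
         32; 33; 37; 38; 41; 42; 44; 48; 49; 51; 59; 61; 69]);
    ([:: 0; 1; 2; 3; 5; 7; 10; 11; 12; 13; 15; 17; 19; 20; 26; 27; 28;
         29; 30; 32; 34; 35; 38; 39; 40; 42; 43; 46; 49; 51; 54; 56;
         59; 60; 63; 64],
     [:: 0; 1; 2; 3; 4; 6; 7; 8; 9; 14; 15; 16; 20; 22; 24; 26; 27;
         31; 33; 36; 37; 40; 42; 43; 46; 49; 54; 57; 58; 68]);
    ([:: 0; 1; 2; 3; 5; 7; 10; 11; 12; 13; 15; 17; 19; 20; 26; 27; 28;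
         29; 30; 32; 34; 35; 38; 39; 40; 42; 43; 46; 49; 51; 54; 56;
         59; 60; 63; 64],
     [:: 0; 1; 3; 4; 6; 7; 8; 9; 10; 14; 15; 18; 19; 20; 22; 25; 26;
         31; 32; 36; 38; 40; 42; 45; 49; 51; 52; 57; 58; 60]);
    ([:: 0; 1; 2; 4; 5; 6; 7; 9; 10; 11; 14; 15; 16; 17; 22; 23; 25;
         26; 29; 30; 33; 35; 37; 38; 43; 45; 46; 48; 50; 51; 52; 54;
         55; 60; 62; 63],
     [:: 0; 2; 3; 5; 7; 8; 9; 11; 14; 17; 18; 19; 21; 23; 24; 27; 30;
         31; 32; 37; 38; 41; 42; 44; 48; 49; 57; 59; 61; 63]);
    ([:: 0; 1; 3; 4; 5; 6; 7; 8; 9; 10; 14; 15; 17; 18; 19; 20; 22;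
         25; 26; 29; 31; 32; 36; 38; 40; 41; 42; 45; 49; 51; 52; 53;
         57; 58; 60; 65],
     [:: 0; 1; 2; 5; 7; 10; 11; 12; 13; 17; 19; 20; 26; 28; 29; 30;
         32; 34; 35; 38; 40; 42; 43; 46; 49; 54; 56; 59; 60; 64]);
    ([:: 0; 1; 3; 4; 5; 6; 7; 8; 9; 10; 14; 15; 17; 18; 19; 20; 22;
         25; 26; 29; 31; 32; 36; 38; 40; 41; 42; 45; 49; 51; 52; 53;
         57; 58; 60; 65],
     [:: 0; 1; 3; 4; 5; 6; 9; 10; 13; 16; 18; 19; 21; 23; 24; 27; 30;
         34; 35; 40; 46; 47; 48; 49; 53; 55; 57; 63; 65; 67]);
    ([:: 0; 2; 3; 4; 5; 7; 8; 9; 11; 14; 15; 16; 17; 18; 19; 23; 24;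
         28; 30; 31; 32; 33; 37; 38; 40; 41; 42; 44; 48; 49; 51; 52;
         59; 61; 64; 69],
     [:: 0; 1; 2; 4; 5; 6; 7; 10; 12; 13; 18; 20; 22; 24; 26; 29; 30;
         31; 35; 37; 40; 43; 44; 47; 52; 53; 56; 58; 59; 62])
  ]%N.

(* The k-th pair in the usual 1-based numbering is (X72 (k - 1), Y72 (k - 1)). *)
Definition X72 (k : 'I_8) : {set 'Z_72} :=
  residues 72 (nth ([::], [::]) pairs72 k).1.

Definition Y72 (k : 'I_8) : {set 'Z_72} :=
  residues 72 (nth ([::], [::]) pairs72 k).2.

(* Main.v *)
Require Import Defs.
From mathcomp Require Import ring zify.

Set Implicit Arguments.
Unset Strict Implicit.
Unset Printing Implicit Defensive.

Import GRing.Theory.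
Local Open Scope ring_scope.

(** The three claims are about counting, and each count is a sum of cardinals
of intersections of a set [X] with its translates [shift c X].

Supplementary difference sets.  The number of pairs of [X] with difference [c]
is the cardinal of [X :&: shift c X].  The indicator bits of [shift c X] are a
rotation of those of [X] ([indicator_shift]), so for explicit sets of residues
the counts are obtained by rotating lists of 72 bits; the SDS property is then
a finite computation ([sds72]).

Golay pairs.  Expanding the product of two entries [1 - 2 * (i \in X)] gives
[paf (binary_seq X) c = v - 4 * #|X| + 4 * diff_count X c]
([paf_binary_seq]).  Hence the two autocorrelations of an SDS with parameters
(v; r, s; lambda) add up to 2v - 4(r + s - lambda), which vanishes as soon as
2(r + s) = v + 2 lambda ([sds_periodic_golay]); here 2(36 + 30) = 72 + 2 * 30.

Nonequivalence.  Difference counts cannot separate the pairs, since some of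
them share their first set and so have the same difference counts in both
components.  The number of three-term arithmetic progressions [x, x + d,
x + 2d] in a set is finer, and it is invariant under every map
[x |-> u * x + t] with [u] a unit ([ap_count_affine]).  All elementary
operations on an SDS are such maps on the components, apart from the exchange
of the two components, so the unordered pair of progression counts is an
invariant of equivalence ([sds_equiv_ap_counts]).  It takes eight different
values on the eight pairs ([ap_counts72], [ap_table72_distinct]). *)

(** * Translates and difference counts *)

Definition shift (v : nat) (c : 'Z_v) (X : {set 'Z_v}) : {set 'Z_v} :=
  [set x | x + c \in X].

Lemma card_shift (v : nat) (c : 'Z_v) (X : {set 'Z_v}) : #|shift c X| = #|X|.
Proof.
have -> : shift c X = (fun x => x + c) @^-1: X by apply/setP=> x; rewrite !inE.
by rewrite card_preimset //; apply: addIr.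
Qed.

Lemma diff_countE (v : nat) (X : {set 'Z_v}) (c : 'Z_v) :
  diff_count X c = #|X :&: shift c X|.
Proof.
pose f (x : 'Z_v) := (x + c, x).
rewrite -(card_imset _ (_ : injective f)); last by move=> x y [].
have subE (a b : 'Z_v) : (a - b == c) = (a == b + c) by rewrite subr_eq addrC.
apply: eq_card => -[a b]; rewrite !inE /= subE.
apply/and3P/imsetP => [[aX bX /eqP a_bc]|[x]].
  by exists b; rewrite /f ?inE -a_bc // bX aX.
by rewrite !inE => /andP[xX xcX] [-> ->]; rewrite xX xcX eqxx.
Qed.

(** * From supplementary difference sets to periodic Golay pairs *)

Lemma binary_seqE (v : nat) (X : {set 'Z_v}) (i : 'Z_v) :
  binary_seq X i = 1 - 2 * (i \in X)%:R.
Proof. by rewrite ffunE; case: (i \in X). Qed.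

(** With [a] and [b] the indicators of [X] at [x] and [x + c], the summand is
[(1 - 2b)(1 - 2a) = 1 - 2b - 2a + 4ab], and [ab] is the indicator of
[X :&: shift c X]. *)
Lemma paf_binary_seq (v : nat) (X : {set 'Z_v}) (c : 'Z_v) :
  (1 < v)%N ->
  paf (binary_seq X) c = v%:R - 4 * #|X|%:R + 4 * (diff_count X c)%:R.
Proof.
move=> v_gt1; have sum_mem (A : {set 'Z_v}) : \sum_x (x \in A)%:R = #|A|%:R :> int.
  by rewrite -sum1_card natr_sum [RHS]big_mkcond; apply: eq_bigr => x _; case: ifP.
have vE : v%:R = #|[set: 'Z_v]|%:R :> int by rewrite cardsT card_ord Zp_cast.
transitivity (\sum_x ((x \in [set: 'Z_v])%:R - 2 * (x \in shift c X)%:R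
    - 2 * (x \in X)%:R + 4 * (x \in X :&: shift c X)%:R) : int).
  apply: eq_bigr => x _; rewrite !binary_seqE !inE.
  by case: (x \in X); case: (x + c \in X).
rewrite !big_split /= !sumrN -!mulr_sumr !sum_mem.
rewrite card_shift -vE -diff_countE; ring.
Qed.

Lemma sds_periodic_golay (v r s lambda : nat) (X Y : {set 'Z_v}) :
  (1 < v)%N -> (2 * (r + s) = v + 2 * lambda)%N -> is_sds r s lambda X Y ->
  periodic_golay_pair (binary_seq X) (binary_seq Y).
Proof.
move=> v_gt1 rsv [cX cY dXY]; split.
- by move=> i; rewrite ffunE; case: ifP; [right|left].
- by move=> i; rewrite ffunE; case: ifP; [right|left].
move=> c c0; rewrite !paf_binary_seq // cX cY; move: (dXY c c0); lia.
Qed.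

(** * Progression counts as an invariant of equivalence *)

(** The number of pairs [(x, d)] with [x], [x + d] and [x + 2d] all in [X]; the
common difference [d] may be zero. *)
Definition ap_count (v : nat) (X : {set 'Z_v}) : nat :=
  \sum_(d : 'Z_v) #|X :&: shift d X :&: shift d (shift d X)|.

(** The map [x |-> u * x + t] sends progressions with common difference [d] to
progressions with common difference [u * d], and [d |-> u * d] is a
bijection. *)
Lemma ap_count_affine (v : nat) (X : {set 'Z_v}) (u t : 'Z_v) :
  u \is a GRing.unit -> ap_count [set u * x + t | x in X] = ap_count X.
Proof.
move=> uU; pose f x := u * x + t.
have injf : injective f by move=> x y /addIr /(mulrI uU).
rewrite /ap_count (reindex_inj (mulrI uU)); apply: eq_bigr => d _.
have mem_fX x : (f x \in [set f z | z in X]) = (x \in X) by rewrite mem_imset.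
have f_step x : f x + u * d = f (x + d) by rewrite /f mulrDr addrAC.
rewrite -[RHS](card_imset _ injf); apply: eq_card => y.
apply/idP/imsetP => [|[x xP ->]]; last first.
  by move: xP; rewrite !inE !f_step !mem_fX.
rewrite !inE => /andP[/andP[/imsetP[x xX ->]]].
rewrite -/(f x) !f_step !mem_fX => xdX xddX.
by exists x; rewrite // !inE xX xdX.
Qed.

Definition ap_counts (v : nat) (P : {set 'Z_v} * {set 'Z_v}) : seq nat :=
  [:: ap_count P.1; ap_count P.2].

(** Translation, negation and multiplication by a unit are affine maps, and the
exchange of the two sets permutes the two counts. *)
Lemma sds_step_ap_counts (v : nat) (P Q : {set 'Z_v} * {set 'Z_v}) :
  sds_step P Q -> perm_eq (ap_counts P) (ap_counts Q).
Proof.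
have translate (X : {set 'Z_v}) t : ap_count [set x + t | x in X] = ap_count X :> nat.
  rewrite -(ap_count_affine X t (unitr1 'Z_v)).
  by congr ap_count; apply: eq_imset => x; rewrite mul1r.
have negate (X : {set 'Z_v}) : ap_count [set - x | x in X] = ap_count X :> nat.
  rewrite -(ap_count_affine X 0 (unitrN1 'Z_v)).
  by congr ap_count; apply: eq_imset => x; rewrite mulN1r addr0.
have dilate (X : {set 'Z_v}) u : u \is a GRing.unit ->
    ap_count [set u * x | x in X] = ap_count X :> nat.
  move=> uU; rewrite -(ap_count_affine X 0 uU).
  by congr ap_count; apply: eq_imset => x; rewrite addr0.
case=> {P Q} [X Y t|X Y t|X Y|X Y|X Y u uU|X Y _];
  rewrite /ap_counts /= ?translate ?negate ?dilate //.
by rewrite (perm_catC [:: _] [:: _]).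
Qed.

Lemma sds_equiv_ap_counts (v : nat) (P Q : {set 'Z_v} * {set 'Z_v}) :
  sds_equiv P Q -> perm_eq (ap_counts P) (ap_counts Q).
Proof.
elim=> {P Q} [P Q /sds_step_ap_counts //|P //|P Q R _ PQ _ QR].
exact: perm_trans PQ QR.
Qed.

(** * Counting with rotations of bit sequences *)

Definition indicator (v : nat) (X : {set 'Z_v}) : bitseq :=
  [seq x \in X | x <- enum 'Z_v].

Definition meet_bits (s t : bitseq) : bitseq :=
  [seq p.1 && p.2 | p <- zip s t].

Lemma rot_iota (n c : nat) :
  (c <= n)%N -> rot c (iota 0 n) = [seq (i + c) %% n | i <- iota 0 n]%N.
Proof.
move=> c_le; rewrite /rot drop_iota take_iota add0n (minn_idPl c_le).
rewrite -[X in map _ (iota 0 X)](subnK c_le) iotaD map_cat add0n; congr (_ ++ _).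
  (* entries below n - c do not wrap around *)
  rewrite -{1}[c]addn0 iotaDl; apply/eq_in_map => i.
  by rewrite mem_iota add0n ltn_subRL => i_lt; rewrite modn_small addnC.
(* the last c entries, n - c + i for i < c, become i modulo n *)
rewrite -[X in map _ (iota X _)]addn0 iotaDl -map_comp -[LHS]map_id.
apply/eq_in_map => i; rewrite mem_iota => i_lt /=.
by rewrite addnAC subnK // modnDl modn_small // (leq_trans i_lt).
Qed.

Lemma card_indicator (v : nat) (X : {set 'Z_v}) : #|X| = count id (indicator X).
Proof. by rewrite count_map cardE -size_filter enumT. Qed.

Lemma indicatorI (v : nat) (X Y : {set 'Z_v}) :
  indicator (X :&: Y) = meet_bits (indicator X) (indicator Y).
Proof.
by rewrite /meet_bits zip_map -map_comp; apply: eq_map => x /=; rewrite inE.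
Qed.

Lemma enum_addr (v : nat) (c : 'Z_v) :
  [seq x + c | x <- enum 'Z_v] = rot c (enum 'Z_v).
Proof.
apply: (inj_map val_inj); rewrite map_rot val_enum_ord.
rewrite rot_iota; last exact: ltnW (ltn_ord c).
by rewrite -val_enum_ord -!map_comp.
Qed.

(** Translating a set rotates its indicator, because adding [c] to the elements
of ['Z_v] in increasing order rotates their list. *)
Lemma indicator_shift (v : nat) (c : 'Z_v) (X : {set 'Z_v}) :
  indicator (shift c X) = rot c (indicator X).
Proof.
rewrite /indicator -map_rot -enum_addr -[RHS]map_comp.
by apply: eq_map => x /=; rewrite inE.
Qed.

Lemma indicator_residues (v : nat) (l : seq nat) :
  indicator (residues v l) = [seq i \in l | i <- iota 0 (Zp_trunc v).+2].
Proof.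
by rewrite -val_enum_ord -map_comp; apply: eq_map => x /=; rewrite inE.
Qed.

Lemma diff_count_indicator (v : nat) (c : 'Z_v) (X : {set 'Z_v}) :
  diff_count X c = count id (meet_bits (indicator X) (rot c (indicator X))).
Proof. by rewrite diff_countE card_indicator indicatorI indicator_shift. Qed.

(** [rot d (rot d s)] and not [rot (d + d) s]: rotating by more than the length
of the sequence is the identity, not a rotation modulo the length. *)
Definition ap_bits (s : bitseq) : nat :=
  sumn [seq count id (meet_bits (meet_bits s (rot d s)) (rot d (rot d s)))
       | d <- iota 0 (size s)].

Lemma ap_count_indicator (v : nat) (X : {set 'Z_v}) :
  ap_count X = ap_bits (indicator X).
Proof.
rewrite /ap_count /ap_bits size_map size_enum_ord sumnE big_map.
rewrite -[iota _ _]/(index_iota 0 (Zp_trunc v).+2) big_mkord.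
by apply: eq_bigr => d _; rewrite card_indicator !indicatorI !indicator_shift.
Qed.

(** * The eight pairs modulo 72 *)

Definition sds72_bits (s t : bitseq) : bool :=
  [&& count id s == 36, count id t == 30 &
      all (fun c => (count id (meet_bits s (rot c s)) +
                     count id (meet_bits t (rot c t)) == 30)%N) (iota 1 71)]%N.

Lemma sds72 (k : 'I_8) : is_sds (v := 72) 36 30 30 (X72 k) (Y72 k).
Proof.
have: sds72_bits (indicator (X72 k)) (indicator (Y72 k)).
  by rewrite !indicator_residues; case: k; do 8?[case; first by vm_compute].
case/and3P=> /eqP cX /eqP cY /allP dXY.
split=> [||c c0]; rewrite ?card_indicator //.
rewrite !diff_count_indicator; apply/eqP/dXY.
by rewrite mem_iota lt0n c0 ltn_ord.
Qed.

Definition ap_table72 : seq (seq nat) :=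
  [:: [:: 656; 368]; [:: 656; 388]; [:: 668; 380]; [:: 668; 376];
      [:: 632; 380]; [:: 648; 396]; [:: 648; 360]; [:: 660; 388]]%N.

Lemma ap_counts72 (k : 'I_8) :
  ap_counts (X72 k, Y72 k) = nth [::] ap_table72 k.
Proof.
rewrite /ap_counts /= !ap_count_indicator !indicator_residues.
by case: k; do 8?[case; first by vm_compute].
Qed.

Lemma ap_table72_distinct (k l : 'I_8) :
  k != l -> ~~ perm_eq (nth [::] ap_table72 k) (nth [::] ap_table72 l).
Proof.
move=> kl; have /allP/(_ (val k)) : all (fun i => all (fun j => (i != j) ==>
    ~~ perm_eq (nth [::] ap_table72 i) (nth [::] ap_table72 j))
    (iota 0 8)) (iota 0 8) by vm_compute.
rewrite mem_iota ltn_ord => /(_ isT) /allP /(_ (val l)).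
by rewrite mem_iota ltn_ord => /(_ isT) /implyP; apply.
Qed.

Theorem mainTheorem1 :
  [/\ (forall k : 'I_8, is_sds (v := 72) 36 30 30 (X72 k) (Y72 k)),
      (forall k l : 'I_8, k != l ->
         ~ sds_equiv (v := 72) (X72 k, Y72 k) (X72 l, Y72 l)),
      (forall k : 'I_8,
         periodic_golay_pair (v := 72)
           (binary_seq (v := 72) (X72 k)) (binary_seq (v := 72) (Y72 k))) &
      (exists A B : {ffun 'Z_72 -> int}, periodic_golay_pair (v := 72) A B)].
Proof.
have golay (k : 'I_8) :
    periodic_golay_pair (v := 72) (binary_seq (X72 k)) (binary_seq (Y72 k)).
  by apply: sds_periodic_golay (sds72 k).
split=> // [|k l kl /sds_equiv_ap_counts|]; first exact: sds72.
  by rewrite !ap_counts72; apply/negP/ap_table72_distinct.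
by exists (binary_seq (X72 ord0)), (binary_seq (Y72 ord0)); apply: golay.
Qed.
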